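(* Let $k\ge3$ be an integer and $\lambda\ge0$. Let $$S_\star(m,x)=\tfrac12(\log(k-1)+1)+\tfrac12\log(1-m^2)-k\lambda^2m^{2k-2}(1-m^2)-(x-\lambda m^k)^2+\Phi_\star\Big(\sqrt{\tfrac{2k}{k-1}}\,x\Big)$$ for $m\in[-1,1]$, $x\in\mathbb R$, with $\Phi_\star$ as in the context, and let $S_\star(m)=\max_{x\in\mathbb R}S_\star(m,x)$. Then for every $m\in[0,1]$, $$S_\star(m)=\begin{cases}S_U(m), & 0\le m<m_c,\\ S_G(m), & m\ge m_c,\end{cases}$$ where $$m_c=\left(\frac1\lambda\,\frac{k-2}{\sqrt{2k(k-1)}}\right)^{1/k},$$ $$S_U(m)=\tfrac12\log(1-m^2)-k\lambda^2m^{2k-2}(1-m^2)+\frac{k}{k-2}\lambda^2m^{2k}+\tfrac12\log(k-1),$$ $$S_G(m)=\tfrac12\log(1-m^2)-k\lambda^2m^{2k-2}(1-m^2)-\tfrac k2\lambda^2m^{2k}+\sqrt{\tfrac k2}\,\lambda m^k\sqrt{1+\tfrac k2\lambda^2m^{2k}}+\sinh^{-1}\Big(\sqrt{\tfrac k2}\,\lambda m^k\Big).$$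
   Context: $$\Phi_\star(x)=\begin{cases}\frac{x^2}{4}-\frac12, & |x|\le 2,\\ \frac{x^2}{4}-\frac12-\frac{|x|}{4}\sqrt{x^2-4}+\log\Big(\sqrt{\frac{x^2}{4}-1}+\frac{|x|}{2}\Big), & |x|>2.\end{cases}$$ Functions take values in the extended reals with $\log 0=-\infty$. When $\lambda=0$, $m_c$ is understood as $+\infty$. *)

(* Defs.v *)
From HB Require Import structures.
From mathcomp Require Import all_boot all_order all_algebra.
From mathcomp Require Import all_classical all_reals all_analysis.

Set Implicit Arguments.
Unset Strict Implicit.
Unset Printing Implicit Defensive.

Import Order.TTheory GRing.Theory Num.Theory.
Import numFieldNormedType.Exports.

Local Open Scope classical_set_scope.
Local Open Scope ring_scope.

Definition sinh {R : realType} (x : R) : R := (expR x - expR (- x)) / 2.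

(* The inverse function of sinh, which is a bijection of the real line. *)
Definition asinh {R : realType} (x : R) : R := get [set y | sinh y = x].

Definition Phi_star {R : realType} (x : R) : R :=
  if `|x| <= 2 then x ^+ 2 / 4 - 1 / 2
  else x ^+ 2 / 4 - 1 / 2 - `|x| / 4 * Num.sqrt (x ^+ 2 - 4)
       + ln (Num.sqrt (x ^+ 2 / 4 - 1) + `|x| / 2).

(* The term log(1 - m^2) / 2 equals -oo at m = 1 and m = -1; it is the only
   term of the functions below that is not a real number. *)
Definition half_log {R : realType} (m : R) : \bar R :=
  ((1 / 2)%:E * lne (1 - m ^+ 2)%:E)%E.

Definition S_star {R : realType} (k : nat) (lam m x : R) : \bar R :=
  ((1 / 2 * (ln (k%:R - 1) + 1))%:E
   + half_log m
   - (k%:R * lam ^+ 2 * m ^+ (2 * k - 2) * (1 - m ^+ 2))%:E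
   - ((x - lam * m ^+ k) ^+ 2)%:E
   + (Phi_star (Num.sqrt (2 * k%:R / (k%:R - 1)) * x))%:E)%E.

(* A supremum; that it is a maximum is the statement that it is attained. *)
Definition S_max {R : realType} (k : nat) (lam m : R) : \bar R :=
  ereal_sup (range (S_star k lam m)).

Definition m_c {R : realType} (k : nat) (lam : R) : \bar R :=
  if lam == 0 then +oo%E
  else ((1 / lam * ((k%:R - 2) / Num.sqrt (2 * k%:R * (k%:R - 1))))
          `^ (1 / k%:R))%:E.

Definition S_U {R : realType} (k : nat) (lam m : R) : \bar R :=
  (half_log m
   - (k%:R * lam ^+ 2 * m ^+ (2 * k - 2) * (1 - m ^+ 2))%:E
   + (k%:R / (k%:R - 2) * lam ^+ 2 * m ^+ (2 * k))%:E
   + (1 / 2 * ln (k%:R - 1))%:E)%E.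

Definition S_G {R : realType} (k : nat) (lam m : R) : \bar R :=
  (half_log m
   - (k%:R * lam ^+ 2 * m ^+ (2 * k - 2) * (1 - m ^+ 2))%:E
   - (k%:R / 2 * lam ^+ 2 * m ^+ (2 * k))%:E
   + (Num.sqrt (k%:R / 2) * lam * m ^+ k
      * Num.sqrt (1 + k%:R / 2 * lam ^+ 2 * m ^+ (2 * k)))%:E
   + (asinh (Num.sqrt (k%:R / 2) * lam * m ^+ k))%:E)%E.

(* Main.v *)
(* Writing |y| = u + 1/u with u >= 1 for |y| >= 2 gives
   Phi_star y = 1/(2u^2) + ln u, and y^2/4 - Phi_star y is convex and constant
   on [-2, 2].  Replacing it by its tangent at y0 = w + 1/w, w >= 1, bounds
   S_star by a quadratic in x, concave because 2k/(k-1) < 4.  One chooses w so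
   that the maximizer of the quadratic is a contact point.  Below m_c the
   maximizer lies in the flat region and w = 1; above it, stationarity reads
   v - 1/v = 2 sqrt(k/2) lam m^k for v = sqrt(k-1) w, so that
   ln v = asinh (sqrt(k/2) lam m^k). *)
Require Import Defs.
From HB Require Import structures.
From mathcomp Require Import all_boot all_order all_algebra.
From mathcomp Require Import all_classical all_reals all_analysis.
From mathcomp Require Import ring lra.

Set Implicit Arguments.
Unset Strict Implicit.
Unset Printing Implicit Defensive.

Import Order.TTheory GRing.Theory Num.Theory.
Import numFieldNormedType.Exports.

Local Open Scope ring_scope.

(** * Convexity in the parameter u *)

Lemma inv_ge1_itv (R : realType) (t : R) : 1 <= t -> 0 < t^-1 <= 1.
Proof. by move=> t1; rewrite invr_gt0 invf_le1; lra. Qed.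

(* Up to the constant 1/2, this is y^2/4 - Phi_star y at y = u + 1/u, u >= 1. *)
Definition psi (R : realType) (u : R) : R := (u ^+ 2 - u^-1 ^+ 2) / 4 - ln u.

(** The factor 1 - 1/t^2 is the derivative of y = t + 1/t; hence [psi], as a function of y, has
    slope (t - 1/t)/2. *)
Lemma is_derive_psi_affine (R : realType) (s t : R) : 0 < t ->
  is_derive t 1 (fun u : R => psi u - s / 2 * (u + u^-1))
    ((1 - t^-1 ^+ 2) / 2 * ((t - t^-1) - s)).
Proof.
move=> t0; have tn0 : t != 0 by rewrite gt_eqF.
have dln : is_derive t 1 (@ln R) t^-1 by exact: is_derive1_ln.
have dV : is_derive t 1 (fun u : R => u^-1) (- t ^- 2).
  have := @is_deriveV R id t 1 1 tn0 (is_derive_id _ _).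
  by rewrite /GRing.scale /= mulr1.
rewrite /psi; apply: is_derive_eq.
by rewrite /GRing.scale /=; field.
Qed.

(** The slope (t - 1/t)/2 increases with t, so [psi] minus its tangent in y decreases on [1, w] and
    increases beyond w. *)
Lemma psi_tangent (R : realType) (u w : R) : 1 <= u -> 1 <= w ->
  psi w + (w - w^-1) / 2 * (u + u^-1 - (w + w^-1)) <= psi u.
Proof.
move=> u1 w1.
set g := fun t : R => psi t - (w - w^-1) / 2 * (t + t^-1).
have MV a b : 1 <= a -> a <= b -> exists2 c : R, c \in `[a, b] &
    g b - g a = (1 - c^-1 ^+ 2) / 2 * ((c - c^-1) - (w - w^-1)) * (b - a).
  move=> a1 ab; have dg t : a <= t -> is_derive t 1 g
      ((1 - t^-1 ^+ 2) / 2 * ((t - t^-1) - (w - w^-1))).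
    by move=> ?; apply: is_derive_psi_affine; lra.
  apply: (MVT_segment ab (f := g)
    (df := fun c => (1 - c^-1 ^+ 2) / 2 * ((c - c^-1) - (w - w^-1)))).
    by move=> t; rewrite in_itv /= => /andP[at_ _]; apply: dg; lra.
  apply: derivable_within_continuous => t; rewrite in_itv /= => /andP[at_ _].
  exact: (@ex_derive _ _ _ _ _ _ _ (dg t at_)).
have mono (a b : R) : 1 <= a -> a <= b -> b^-1 <= a^-1.
  by move=> a1 ab; rewrite lef_pV2 ?posrE; lra.
suff : g w <= g u by rewrite /g; lra.
have [uw|/ltW wu] := leP u w.
  have [c] := MV _ _ u1 uw.
  rewrite in_itv /= => /andP[uc cw] e.
  have c1 : 1 <= c by lra.
  have := mono _ _ c1 cw; have /andP[] := inv_ge1_itv c1; move: e.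
  move: (c^-1) => d e d0 d1 wd.
  suff : 0 <= (1 - d ^+ 2) / 2 * ((w - w^-1) - (c - d)) * (w - u) by lra.
  by rewrite !mulr_ge0 //; nra.
have [c] := MV _ _ w1 wu.
rewrite in_itv /= => /andP[wc cu] e.
have c1 : 1 <= c by lra.
have := mono _ _ w1 wc; have /andP[] := inv_ge1_itv c1; move: e.
move: (c^-1) => d e d0 d1 wd.
suff : 0 <= (1 - d ^+ 2) / 2 * ((c - d) - (w - w^-1)) * (u - w) by lra.
by rewrite !mulr_ge0 //; nra.
Qed.

(** * Tangent bound for [Phi_star] *)

Lemma Phi_star_param (R : realType) (u : R) : 1 <= u ->
  Phi_star (u + u^-1) = u^-1 ^+ 2 / 2 + ln u.
Proof.
move=> u1.
have uV : u * u^-1 = 1 by rewrite mulfV //; lra.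
have /andP[u0 uV1] := inv_ge1_itv u1.
rewrite /Phi_star ger0_norm; last lra.
case: ifPn => [le2|_].
  (* Here u + 1/u <= 2, that is, (u - 1)^2 <= 0. *)
  have -> : u = 1 by move: (u^-1) uV u0 uV1 le2 => d; nra.
  by rewrite invr1 ln1; lra.
have -> : Num.sqrt ((u + u^-1) ^+ 2 - 4) = u - u^-1.
  rewrite -[RHS]ger0_norm; last lra.
  by rewrite -sqrtr_sqr; congr Num.sqrt; lra.
have -> : Num.sqrt ((u + u^-1) ^+ 2 / 4 - 1) = (u - u^-1) / 2.
  rewrite -[RHS]ger0_norm; last lra.
  by rewrite -sqrtr_sqr; congr Num.sqrt; lra.
have -> : (u - u^-1) / 2 + (u + u^-1) / 2 = u by lra.
lra.
Qed.

Lemma Phi_star_norm (R : realType) (y : R) : Phi_star `|y| = Phi_star y.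
Proof. by rewrite /Phi_star normr_id real_normK ?num_real. Qed.

Lemma Phi_star_tangent (R : realType) (w y : R) : 1 <= w ->
  Phi_star y <= y ^+ 2 / 4
    - (1 / 2 + psi w + (w - w^-1) / 2 * (y - (w + w^-1))).
Proof.
move=> w1.
have wV : w * w^-1 = 1 by rewrite mulfV //; lra.
have /andP[w0 wV1] := inv_ge1_itv w1.
have [le2|gt2] := leP `|y| 2.
  (* Here y^2/4 - [Phi_star y] is 1/2, its value at y = 2 (u = 1); the tangent has nonnegative
     slope, so it only drops from 2 down to y. *)
  rewrite /Phi_star le2; have /ler_normlP[_ y2] := le2.
  have := psi_tangent (lexx 1) w1.
  rewrite {2}/psi invr1 ln1 => H.
  have : 0 <= (w - w^-1) / 2 * (2 - y) by apply: mulr_ge0; lra.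
  lra.
set r := Num.sqrt (y ^+ 2 / 4 - 1).
have y2 : `|y| ^+ 2 = y ^+ 2 by rewrite real_normK ?num_real.
have r0 : 0 <= r by rewrite sqrtr_ge0.
have r2 : r ^+ 2 = y ^+ 2 / 4 - 1 by rewrite sqr_sqrtr //; nra.
(* The larger root of u + 1/u = |y|. *)
set u := `|y| / 2 + r.
have u1 : 1 <= u by rewrite /u; lra.
have uVE : u^-1 = `|y| / 2 - r.
  have un0 : u != 0 by lra.
  by apply: (mulfI un0); rewrite mulfV // /u; lra.
have uy : u + u^-1 = `|y| by rewrite uVE /u; lra.
rewrite -Phi_star_norm -uy Phi_star_param //.
have uV : u * u^-1 = 1 by rewrite mulfV //; lra.
have := psi_tangent u1 w1; rewrite {2}/psi -y2 -uy.
(* A nonnegative slope and y <= |y| settle negative y as well. *)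
have yu : 0 <= (w - w^-1) / 2 * (u + u^-1 - y).
  by apply: mulr_ge0; rewrite ?uy; [lra|have := ler_norm y; lra].
lra.
Qed.

(** * Maximization in x, in both regimes *)

(* The x-dependent part of S_star, with a = sqrt (2k/(k-1)) and c = lam m^k. *)
Definition obj (R : realType) (a c x : R) : R :=
  - (x - c) ^+ 2 + Phi_star (a * x).

Lemma objN (R : realType) (a c x : R) : obj a (- c) (- x) = obj a c x.
Proof. by rewrite /obj mulrN -Phi_star_norm normrN Phi_star_norm; lra. Qed.

(** The bound is the value at x0 of the quadratic majorant given by the tangent at w + 1/w. The
    equation says that half its derivative vanishes at x0; its leading coefficient a^2/4 - 1 is at
    most 0. *)
Lemma obj_le_stationary (R : realType) (a c w x0 x : R) :
  a ^+ 2 <= 4 -> 1 <= w ->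
  c - x0 + a ^+ 2 * x0 / 4 = a * (w - w^-1) / 4 ->
  obj a c x <= - (x0 - c) ^+ 2 + (a * x0) ^+ 2 / 4
    - (1 / 2 + psi w + (w - w^-1) / 2 * (a * x0 - (w + w^-1))).
Proof.
move=> a4 w1 stat; rewrite /obj.
have := Phi_star_tangent (a * x) w1.
have : 0 <= (1 - a ^+ 2 / 4) * (x - x0) ^+ 2.
  by rewrite mulr_ge0 ?sqr_ge0 //; lra.
have : (c - x0 + a ^+ 2 * x0 / 4) * (x - x0) =
       a * (w - w^-1) / 4 * (x - x0) by rewrite stat.
lra.
Qed.

Lemma obj_max_quadratic (R : realType) (a c : R) :
  0 < a -> a ^+ 2 < 4 -> 0 <= c -> a * c <= 2 - a ^+ 2 / 2 ->
  exists2 x0, forall x, obj a c x <= obj a c x0 &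
    obj a c x0 = a ^+ 2 / (4 - a ^+ 2) * c ^+ 2 - 1 / 2.
Proof.
move=> a0 a4 c0 ac.
have d0 : 4 - a ^+ 2 != 0 by rewrite subr_eq0 gt_eqF.
(* Stationary point for w = 1; the bound on a c says exactly a x0 <= 2, so the majorant touches
   [obj] there. *)
pose x0 := 4 * c / (4 - a ^+ 2).
have ax0 : `|a * x0| <= 2.
  rewrite ger0_norm; last by rewrite !mulr_ge0 ?invr_ge0 //; lra.
  by rewrite mulrA ler_pdivrMr; lra.
have Ex0 : obj a c x0 = - (x0 - c) ^+ 2 + (a * x0) ^+ 2 / 4 - 1 / 2.
  by rewrite /obj /Phi_star ax0; lra.
exists x0 => [x|]; last by rewrite Ex0 /x0; field.
rewrite Ex0.
have := @obj_le_stationary R a c 1 x0 x (ltW a4) (lexx 1).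
rewrite /psi invr1 ln1 => H.
have stat : c - x0 + a ^+ 2 * x0 / 4 = a * (1 - 1) / 4.
  by rewrite /x0; field.
have := H stat; lra.
Qed.

(** The equation for a c is stationarity at the contact point a x0 = w + 1/w, where it reads x0 - c
    = a/(2w). *)
Lemma obj_max_tail (R : realType) (a c w : R) :
  0 < a -> a ^+ 2 <= 4 -> 1 <= w ->
  a * c = w + w^-1 - a ^+ 2 / 2 * w^-1 ->
  exists2 x0, forall x, obj a c x <= obj a c x0 &
    obj a c x0 = (1 / 2 - a ^+ 2 / 4) * w^-1 ^+ 2 + ln w.
Proof.
move=> a0 a4 w1 acE; have an0 : a != 0 by rewrite gt_eqF.
have wV : w * w^-1 = 1 by rewrite mulfV //; lra.
pose x0 := (w + w^-1) / a.
have ax0 : a * x0 = w + w^-1 by rewrite /x0; field; lra.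
have x0c : x0 - c = a / 2 * w^-1.
  by apply: (mulfI an0); rewrite mulrBr ax0 acE; lra.
have Ex0 : obj a c x0 = (1 / 2 - a ^+ 2 / 4) * w^-1 ^+ 2 + ln w.
  by rewrite /obj ax0 x0c Phi_star_param //; lra.
exists x0 => // x; rewrite Ex0.
have := @obj_le_stationary R a c w x0 x a4 w1.
rewrite ax0 x0c subrr mulr0 addr0 /psi => H.
have stat : c - x0 + a ^+ 2 * x0 / 4 = a * (w - w^-1) / 4.
  have -> : a ^+ 2 * x0 = a * (w + w^-1) by rewrite -ax0; lra.
  by rewrite -opprB x0c; lra.
have := H stat; lra.
Qed.

(** * Logarithmic form of [asinh] and the regime above the threshold *)

Lemma sqrt1D_gt0 (R : realType) (z : R) : 0 < z + Num.sqrt (1 + z ^+ 2).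
Proof.
have : `|z| < Num.sqrt (1 + z ^+ 2).
  by rewrite -sqrtr_sqr ltr_sqrt; have := sqr_ge0 z; lra.
by rewrite ltr_norml => /andP[? _]; lra.
Qed.

Lemma sqrt1D_inv (R : realType) (z : R) :
  (z + Num.sqrt (1 + z ^+ 2))^-1 = Num.sqrt (1 + z ^+ 2) - z.
Proof.
have v0 := lt0r_neq0 (sqrt1D_gt0 z).
have s2 : Num.sqrt (1 + z ^+ 2) ^+ 2 = 1 + z ^+ 2.
  by rewrite sqr_sqrtr //; have := sqr_ge0 z; lra.
by apply: (mulfI v0); rewrite mulfV //; lra.
Qed.

Lemma asinhE (R : realType) (z : R) :
  asinh z = ln (z + Num.sqrt (1 + z ^+ 2)).
Proof.
have v0 := sqrt1D_gt0 z.
apply: get_unique => [|y] /=.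
  by rewrite /sinh expRN lnK ?posrE // sqrt1D_inv; lra.
rewrite /sinh expRN => yz.
have e0 := expR_gt0 y.
have ee : expR y * (expR y)^-1 = 1 by rewrite mulfV // gt_eqF.
have i0 : 0 < (expR y)^-1 by rewrite invr_gt0.
apply: expR_inj; rewrite lnK ?posrE //.
(* For z = sinh y, 1 + z^2 = cosh^2 y, so z plus the root is exp y. *)
have -> : 1 + z ^+ 2 = ((expR y + (expR y)^-1) / 2) ^+ 2 by rewrite -yz; lra.
by rewrite sqrtr_sqr ger0_norm; lra.
Qed.

(** Stationarity reads w - r^2/w = a c; with v = w/r and a = 2 b r it becomes v - 1/v = 2 b c, so v
    = exp (asinh (b c)). *)
Lemma obj_max_asinh (R : realType) (a b r c : R) :
  0 < a -> 0 < r -> a = 2 * b * r -> a ^+ 2 = 2 * (1 + r ^+ 2) ->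
  a ^+ 2 <= 4 -> 2 - a ^+ 2 / 2 <= a * c ->
  exists2 x0, forall x, obj a c x <= obj a c x0 &
    obj a c x0 = - (b * c) ^+ 2 + b * c * Num.sqrt (1 + (b * c) ^+ 2)
      + asinh (b * c) - 1 / 2 + ln r.
Proof.
move=> a0 r0 aE a2 a4 ac; rewrite asinhE.
set z := b * c; set s := Num.sqrt _.
have s2 : s ^+ 2 = 1 + z ^+ 2 by rewrite sqr_sqrtr //; have := sqr_ge0 z; lra.
have v0 : 0 < z + s := sqrt1D_gt0 z.
have vV : (z + s)^-1 = s - z := sqrt1D_inv z.
pose w := r * (z + s).
have w0 : 0 < w by rewrite mulr_gt0.
have wVE : w^-1 = r^-1 * (s - z) by rewrite invfM vV.
have rV : r * r^-1 = 1 by rewrite mulfV ?gt_eqF.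
have acE : a * c = w + w^-1 - a ^+ 2 / 2 * w^-1.
  have -> : a * c = 2 * r * z by rewrite aE /z; lra.
  have -> : w + w^-1 - a ^+ 2 / 2 * w^-1 = w - r ^+ 2 * w^-1 by rewrite a2; lra.
  have -> : r ^+ 2 * w^-1 = r * (s - z).
    by rewrite wVE mulrA expr2 -(mulrA r) rV mulr1.
  rewrite /w; lra.
have w1 : 1 <= w.
  have wV : w * w^-1 = 1 by rewrite mulfV ?gt_eqF.
  have r2wV : r ^+ 2 * (w * w^-1) = r ^+ 2 by rewrite wV mulr1.
  (* Since 2 - a^2/2 = 1 - r^2, this product carries the sign of the threshold condition. *)
  have : 0 <= (w - 1) * (w + r ^+ 2).
    have -> : (w - 1) * (w + r ^+ 2) = w * (a * c - (2 - a ^+ 2 / 2)).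
      by rewrite acE a2; lra.
    by rewrite mulr_ge0 //; lra.
  by rewrite pmulr_lge0 ?subr_ge0 //; have := sqr_ge0 r; lra.
have [x0 mx e] := obj_max_tail a0 a4 w1 acE.
exists x0 => //; rewrite e.
have -> : ln w = ln r + ln (z + s) by rewrite lnM ?posrE.
(* Uses 1/2 - a^2/4 = -r^2/2 and r/w = s - z; with s^2 = 1 + z^2 the result is -z^2 + z s - 1/2. *)
have -> : (1 / 2 - a ^+ 2 / 4) * w^-1 ^+ 2 = - (1 / 2) * (s - z) ^+ 2.
  have -> : (s - z) ^+ 2 = (r * w^-1) ^+ 2 by rewrite wVE mulrA rV mul1r.
  rewrite a2; lra.
lra.
Qed.

(** * The constants as functions of K *)

Section scaled_objective.
Variables (R : realType) (K : R).

Local Notation a := (Num.sqrt (2 * K / (K - 1))).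
Local Notation b := (Num.sqrt (K / 2)).
Local Notation r := ((Num.sqrt (K - 1))^-1).
Local Notation Q := ((K - 2) / Num.sqrt (2 * K * (K - 1))).

Lemma scale_sqr (K3 : 3 <= K) : a ^+ 2 = 2 * K / (K - 1).
Proof. by rewrite sqr_sqrtr // divr_ge0 //; lra. Qed.

Lemma scale_gt0 (K3 : 3 <= K) : 0 < a.
Proof. by rewrite sqrtr_gt0 divr_gt0 //; lra. Qed.

Lemma scale_sqr_lt4 (K3 : 3 <= K) : a ^+ 2 < 4.
Proof. by rewrite (scale_sqr K3) ltr_pdivrMr; lra. Qed.

Lemma sqrt_half_sqr (K3 : 3 <= K) : b ^+ 2 = K / 2.
Proof. by rewrite sqr_sqrtr // divr_ge0 //; lra. Qed.

Lemma invsqrt_gt0 (K3 : 3 <= K) : 0 < r.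
Proof. by rewrite invr_gt0 sqrtr_gt0; lra. Qed.

Lemma invsqrt_sqr (K3 : 3 <= K) : r ^+ 2 = (K - 1)^-1.
Proof. by rewrite exprVn sqr_sqrtr //; lra. Qed.

Lemma scaleE (K3 : 3 <= K) : a = 2 * b * r.
Proof.
rewrite -[RHS]ger0_norm; last by rewrite !mulr_ge0 ?sqrtr_ge0 // ltW.
rewrite -sqrtr_sqr !exprMn (sqrt_half_sqr K3) (invsqrt_sqr K3).
by congr Num.sqrt; field; lra.
Qed.

Lemma ln_invsqrt (K3 : 3 <= K) : ln r = - (1 / 2 * ln (K - 1)).
Proof.
have : ln (r ^+ 2) = - ln (K - 1) by rewrite (invsqrt_sqr K3) lnV ?posrE //; lra.
by rewrite lnXn ?(invsqrt_gt0 K3) // => H; lra.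
Qed.

(** As sqrt (2K(K - 1)) = a (K - 1), both a Q and 2 - a^2/2 equal (K - 2)/(K - 1). *)
Lemma lt_thresholdE (K3 : 3 <= K) (c : R) : (c < Q) = (a * c < 2 - a ^+ 2 / 2).
Proof.
have sE : Num.sqrt (2 * K * (K - 1)) = a * (K - 1).
  rewrite -[RHS]ger0_norm; last by rewrite mulr_ge0 ?(ltW (scale_gt0 K3)) //; lra.
  by rewrite -sqrtr_sqr exprMn (scale_sqr K3); congr Num.sqrt; field; lra.
have -> : 2 - a ^+ 2 / 2 = a * Q.
  by rewrite (scale_sqr K3) sE; field;
    rewrite (lt0r_neq0 (scale_gt0 K3)) andbT; lra.
by rewrite (ltr_pM2l (scale_gt0 K3)).
Qed.

Lemma obj_max (K3 : 3 <= K) (c : R) : 0 <= c ->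
  exists2 x0, forall x, obj a c x <= obj a c x0 &
    obj a c x0 = if c < Q then K / (K - 2) * c ^+ 2 - 1 / 2
      else - (b * c) ^+ 2 + b * c * Num.sqrt (1 + (b * c) ^+ 2)
           + asinh (b * c) - 1 / 2 - 1 / 2 * ln (K - 1).
Proof.
move=> c0; rewrite (lt_thresholdE K3); case: ltP => ac.
  have [x0 mx e] :=
    obj_max_quadratic (scale_gt0 K3) (scale_sqr_lt4 K3) c0 (ltW ac).
  by exists x0 => //; rewrite e (scale_sqr K3); field; lra.
have a_sqr : a ^+ 2 = 2 * (1 + r ^+ 2).
  by rewrite (scale_sqr K3) (invsqrt_sqr K3); field; lra.
have [x0 mx e] := obj_max_asinh (scale_gt0 K3) (invsqrt_gt0 K3)
  (scaleE K3) a_sqr (ltW (scale_sqr_lt4 K3)) ac.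
by exists x0 => //; rewrite e (ln_invsqrt K3); lra.
Qed.

End scaled_objective.

(** * Return to extended real values and to m *)

Section S_max.
Variables (R : realType) (k : nat).
Hypothesis k3 : (3 <= k)%N.

Local Notation K := (k%:R : R).
Local Notation a := (Num.sqrt (2 * K / (K - 1))).
Local Notation b := (Num.sqrt (K / 2)).
Local Notation Q := ((K - 2) / Num.sqrt (2 * K * (K - 1))).

Lemma natr_k_ge3 : 3 <= K. Proof. by rewrite ler_nat. Qed.

(** Splits off the possibly infinite term, which does not depend on x, so that the maximization is
    over real values. *)
Lemma S_starE (lam m x : R) : S_star k lam m x = (half_log m +
  (1 / 2 * (ln (K - 1) + 1) - K * lam ^+ 2 * m ^+ (2 * k - 2) * (1 - m ^+ 2)
   + obj a (lam * m ^+ k) x)%:E)%E.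
Proof.
rewrite /S_star; case: (half_log m) => [h| |] //=.
by congr EFin; rewrite /obj; lra.
Qed.

Lemma S_max_argmax (lam m x0 : R) :
  (forall x, obj a (lam * m ^+ k) x <= obj a (lam * m ^+ k) x0) ->
  S_max k lam m = S_star k lam m x0.
Proof.
move=> mx; apply/le_anti/andP; split; last by apply: ereal_sup_ubound; exists x0.
apply: ge_ereal_sup => _ [x _ <-]; rewrite !S_starE leeD2l // lee_fin.
by have := mx x; lra.
Qed.

(** Taking k-th powers is strictly increasing on nonnegative reals; for lam = 0 both sides hold,
    since Q > 0. *)
Lemma lt_m_c (lam m : R) : 0 <= lam -> 0 <= m ->
  (m%:E < m_c k lam)%E = (lam * m ^+ k < Q).
Proof.
have k_ge3 := natr_k_ge3.
move=> lam0 m0; rewrite /m_c; case: eqP => [->|/eqP lamn0].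
  rewrite mul0r ltry; apply/esym; rewrite divr_gt0 ?sqrtr_gt0 ?mulr_gt0 //; lra.
have lp : 0 < lam by rewrite lt_def lamn0.
have z0 : 0 <= 1 / lam * Q.
  by rewrite mulr_ge0 ?divr_ge0 ?sqrtr_ge0 //; lra.
have Kn0 : K != 0 by lra.
set z := 1 / lam * Q in z0 *.
have zk : (z `^ (1 / K)) ^+ k = z.
  by rewrite -powR_mulrn ?powR_ge0 // -powRrM div1r mulVf // powRr1.
rewrite lte_fin -(@ltr_pXn2r _ k) ?nnegrE ?powR_ge0 //; last by case: k k3.
by rewrite zk /z -ltr_pdivlMl // div1r.
Qed.

Lemma S_max_attained (lam m : R) :
  exists x, S_star k lam m x = S_max k lam m.
Proof.
set c := lam * m ^+ k.
suff [x0 mx] : exists x0, forall x, obj a c x <= obj a c x0.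
  by exists x0; rewrite (S_max_argmax mx).
(* For m < 0 and odd k, c can be negative; evenness of [Phi_star] reflects x to -x. *)
have [c0|c0] := leP 0 c; first by have [x0 mx _] := obj_max natr_k_ge3 c0; exists x0.
have [|x0 mx _] := @obj_max R K natr_k_ge3 (- c); first by lra.
by exists (- x0) => x; rewrite -!(objN _ c) opprK.
Qed.

(** The constant (ln (K - 1) + 1)/2 of [S_star] absorbs the -1/2 of [obj_max] in both branches, and
    its -ln (K - 1)/2 in the second. *)
Lemma S_maxE (lam m : R) : 0 <= lam -> 0 <= m ->
  S_max k lam m =
    if (m%:E < m_c k lam)%E then S_U k lam m else S_G k lam m.
Proof.
move=> lam0 m0; rewrite lt_m_c //.
have [|x0 mx e] := @obj_max R K natr_k_ge3 (lam * m ^+ k).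
  by rewrite mulr_ge0 ?exprn_ge0.
rewrite (S_max_argmax mx) S_starE e.
have m2k : m ^+ (2 * k) = (m ^+ k) ^+ 2 by rewrite mulnC exprM.
case: ifP => _; rewrite /S_U /S_G m2k; case: (half_log m) => [h| |] //=.
  by congr EFin; move: (m ^+ k) (m ^+ (2 * k - 2)) => u v; lra.
congr EFin; move: (m ^+ k) (m ^+ (2 * k - 2)) => u v.
have -> : K / 2 * lam ^+ 2 * u ^+ 2 = (b * (lam * u)) ^+ 2.
  by rewrite !exprMn sqrt_half_sqr ?natr_k_ge3 //; lra.
rewrite -(mulrA b lam); lra.
Qed.

End S_max.

Theorem proposition1 (R : realType) (k : nat) (lam : R)
    (hk : (3 <= k)%N) (hlam : 0 <= lam) :
  (forall m : R, -1 <= m <= 1 ->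
     exists x : R, S_star k lam m x = S_max k lam m) /\
  (forall m : R, 0 <= m <= 1 ->
     S_max k lam m =
       if (m%:E < m_c k lam)%E then S_U k lam m else S_G k lam m).
Proof.
split=> [m _|m /andP[m0 _]]; first exact: S_max_attained.
exact: S_maxE.
Qed.
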